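(* Let $\mathbb{U}$ be a nonempty set of inputs and let $H:\mathbb{U}^{*}\to\mathbb{R}^{n_y}$ be a map, with associated family $\Psi_H=\{H_u\}_{u\in\mathbb{U}}$, $H_u(w)=H(uw)-H(w)$. Then: (1) $H$ can be realized by a globally uniformly exponentially stable (GUES) state-affine system (SAS) if and only if $H$ is uniformly forgetting (UF) and $\Psi_H$ has a finite Hankel-rank. (2) If $\Psi_H$ has a finite Hankel-rank, then $H$ is UF if and only if $H$ is uniformly exponentially forgetting (UEF) (with some rate $\beta\in(0,1)$). (3) If $H$ is UEF with rate $\beta$, then all minimal SAS realizations of $H$ are GUES with rate $\beta$.
   Context: Words: for a set $X$, $X^{*}$ is the set of all finite words over $X$, including the empty word $\epsilon$; $X^{+}=X^{*}\setminus\{\epsilon\}$; $|w|$ is the length of $w$, $w[k]$ its $k$-th letter, and $vw$ denotes concatenation. For matrices $\{A_x\}_{x\in X}$ and $w\in X^{*}$, $A_w=A_{w[|w|]}\cdots A_{w[1]}$ for nonempty $w$ and $A_\epsilon=I_n$. $\|\cdot\|_2$ is the Euclidean norm of vectors and the spectral norm of matrices. A state-affine system (SAS) is a system $x(t+1)=A_{u(t)}x(t)+b_{u(t)}$, $x(0)=x_0$, $y(t)=Cx(t)+d$, with $A_u\in\mathbb{R}^{n\times n}$, $b_u\in\mathbb{R}^n$ for $u\in\mathbb{U}$, $C\in\mathbb{R}^{n_y\times n}$, $d\in\mathbb{R}^{n_y}$, and a single initial state $x_0\in\mathbb{R}^n$; its dimension is $n$. It is a realization of $H$ if for every $w\in\mathbb{U}^{*}$,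 $H(w)=Cx+d$ where $x$ is the state reached from $x_0$ after applying the inputs $w[1],\ldots,w[|w|]$ (and $x=x_0$ if $w=\epsilon$). It is a minimal SAS realization of $H$ if its dimension is minimal among all SAS realizations of $H$. A SAS is GUES with rate $\beta\in(0,1)$ if its associated state-linear system $(\{A_u\}_{u\in\mathbb{U}},\{B_u\}_{u\in\mathbb{U}},C)$ with initial states $B_u=A_ux_0+b_u-x_0$ is GUES with rate $\beta$, i.e. the set $\{B_u\}_{u\in\mathbb{U}}$ is bounded and there is $C_g\ge1$ with $\|A_w\|_2\le C_g\beta^{|w|}$ for all $w\in\mathbb{U}^{*}$. It is GUES if it is GUES with some rate $\beta\in(0,1)$. Hankel-rank: for $F:\mathbb{U}^{*}\to\mathbb{R}^{n_y}$ and $v\in\mathbb{U}^{*}$, let $v\circ F:w\mapsto F(vw)$. The Hankel-rank of $\Psi_H$ is the dimension of $W_{\Psi_H}=\mathrm{Span}\{v\circ H_u\mid u\in\mathbb{U},\ v\in\mathbb{U}^{*}\}$ (pointwise linear operations). UF: $H$ is uniformly forgetting (UF) if $\sup_{v\in\mathbb{U}^{*},\,u\in\mathbb{U}}\|H(uv)-H(v)\|_2<+\infty$ and $\lim_{t\to\infty}\sup_{v\in\mathbb{U}^{+},\,|v|=t,\,w\in\mathbb{U}^{*}}\|H(wv)-H(v)\|_2=0$. UEF: $H$ is uniformly exponentially forgetting (UEF) with rate $\beta\in(0,1)$ if there is $C_f>0$ such that $\sup_{w\in\mathbb{U}^{*}}\|H(wv)-H(v)\|_2\le C_f\beta^{|v|}$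 for all $v\in\mathbb{U}^{*}$. *)

(* Defs.v *)
From HB Require Import structures.
From mathcomp Require Import all_boot all_order all_algebra.
From mathcomp Require Import all_classical all_reals all_analysis.

Set Implicit Arguments.
Unset Strict Implicit.
Unset Printing Implicit Defensive.

Import Order.TTheory GRing.Theory Num.Theory.
Import numFieldNormedType.Exports.

Local Open Scope classical_set_scope.
Local Open Scope ring_scope.

(* The library's norm on matrices is the max norm, so the Euclidean norm and
   the spectral norm (the operator norm it induces) are defined here. *)
Definition norm2 (R : realType) (n : nat) (x : 'cV[R]_n) : R :=
  Num.sqrt (\sum_(i < n) x i 0 ^+ 2).

Definition spectral_norm (R : realType) (m n : nat) (A : 'M[R]_(m, n)) : R :=
  sup [set norm2 (A *m x) | x in [set x : 'cV[R]_n | norm2 x <= 1]].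

Definition lin_span (R : realType) (V : lmodType R) (S : set V) : set V :=
  [set v | exists (m : nat) (c : 'I_m -> R) (s : 'I_m -> V),
     (forall i, S (s i)) /\ v = \sum_(i < m) c i *: s i].

Definition lin_indep (R : realType) (V : lmodType R) (n : nat)
    (e : 'I_n -> V) : Prop :=
  forall c : 'I_n -> R, \sum_(i < n) c i *: e i = 0 -> forall i, c i = 0.

Definition has_dim (R : realType) (V : lmodType R) (W : set V) (n : nat) : Prop :=
  exists e : 'I_n -> V, lin_indep e /\ lin_span (range e) = W.

(* Words over U are sequences, w[1] being the head. *)

(* A_w = A_{w[|w|]} ... A_{w[1]}: the first letter is the rightmost factor. *)
Definition word_mx (R : realType) (U : Type) (n : nat) (A : U -> 'M[R]_n)
    (w : seq U) : 'M[R]_n :=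
  foldl (fun M u => A u *m M) 1%:M w.

(* v o F *)
Definition word_shift (U T : Type) (v : seq U) (F : seq U -> T) : seq U -> T :=
  fun w => F (v ++ w).

(* Psi_H = {H_u}_u *)
Definition assoc_family (R : realType) (U : Type) (ny : nat)
    (H : seq U -> 'cV[R]_ny) (u : U) : seq U -> 'cV[R]_ny :=
  fun w => H (u :: w) - H w.

(* W_Psi, as a subset of the function space with pointwise operations *)
Definition hankel_space (R : realType) (U J : Type) (ny : nat)
    (Psi : J -> seq U -> 'cV[R]_ny) : set (seq U -> 'cV[R]_ny) :=
  lin_span [set F | exists (j : J) (v : seq U), F = word_shift v (Psi j)].

Definition finite_hankel_rank (R : realType) (U J : Type) (ny : nat)
    (Psi : J -> seq U -> 'cV[R]_ny) : Prop :=
  exists r : nat, has_dim (hankel_space Psi) r.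

(* State-linear systems, with a family of initial states indexed by J *)
Record sls (R : realType) (U J : Type) (ny n : nat) := SLS {
  sls_A : U -> 'M[R]_n;
  sls_B : J -> 'cV[R]_n;
  sls_C : 'M[R]_(ny, n) }.

Definition sls_GUES (R : realType) (U J : Type) (ny n : nat)
    (L : sls R U J ny n) (beta : R) : Prop :=
  [/\ 0 < beta < 1,
      exists K : R, forall j, norm2 (sls_B L j) <= K &
      exists2 Cg : R, 1 <= Cg &
        forall w : seq U,
          spectral_norm (word_mx (sls_A L) w) <= Cg * beta ^+ size w].

(* State-affine systems of dimension n; n = 0 is allowed. *)
Record sas (R : realType) (U : Type) (ny n : nat) := SAS {
  sas_A : U -> 'M[R]_n;
  sas_b : U -> 'cV[R]_n;
  sas_C : 'M[R]_(ny, n);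
  sas_d : 'cV[R]_ny;
  sas_x0 : 'cV[R]_n }.

Definition sas_state (R : realType) (U : Type) (ny n : nat)
    (S : sas R U ny n) (w : seq U) : 'cV[R]_n :=
  foldl (fun x u => sas_A S u *m x + sas_b S u) (sas_x0 S) w.

Definition sas_realizes (R : realType) (U : Type) (ny n : nat)
    (S : sas R U ny n) (H : seq U -> 'cV[R]_ny) : Prop :=
  forall w, H w = sas_C S *m sas_state S w + sas_d S.

Definition sas_minimal (R : realType) (U : Type) (ny n : nat)
    (S : sas R U ny n) (H : seq U -> 'cV[R]_ny) : Prop :=
  sas_realizes S H /\
  forall (m : nat) (S' : sas R U ny m), sas_realizes S' H -> (n <= m)%N.

Definition sas_sls (R : realType) (U : Type) (ny n : nat)
    (S : sas R U ny n) : sls R U U ny n :=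
  SLS (sas_A S) (fun u => sas_A S u *m sas_x0 S + sas_b S u - sas_x0 S)
      (sas_C S).

Definition sas_GUES_rate (R : realType) (U : Type) (ny n : nat)
    (S : sas R U ny n) (beta : R) : Prop :=
  sls_GUES (sas_sls S) beta.

Definition sas_GUES (R : realType) (U : Type) (ny n : nat)
    (S : sas R U ny n) : Prop :=
  exists beta : R, sas_GUES_rate S beta.

(* Suprema are taken in the extended reals, so that unbounded sets have
   supremum +oo.  For t = 0 the set in the limit below is empty (v must be
   nonempty), which does not affect the limit. *)
Definition UF (R : realType) (U : Type) (ny : nat)
    (H : seq U -> 'cV[R]_ny) : Prop :=
  (ereal_sup [set z | exists (v : seq U) (u : U),
      z = (norm2 (H (u :: v) - H v))%:E] < +oo)%E /\
  (fun t : nat =>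
     ereal_sup [set z | exists v w : seq U,
       [/\ (0 < size v)%N, size v = t & z = (norm2 (H (w ++ v) - H v))%:E]])
    @ \oo --> 0%E.

Definition UEF (R : realType) (U : Type) (ny : nat)
    (H : seq U -> 'cV[R]_ny) (beta : R) : Prop :=
  0 < beta < 1 /\
  exists2 Cf : R, 0 < Cf &
    forall v : seq U,
      (ereal_sup [set z | exists w : seq U,
         z = (norm2 (H (w ++ v) - H v))%:E] <= (Cf * beta ^+ size v)%:E)%E.

(* Main.v *)
Require Import Defs.
From mathcomp Require Import all_boot all_order all_algebra.
From mathcomp Require Import all_classical all_reals all_analysis.
From mathcomp Require Import ring lra.

Set Implicit Arguments.
Unset Strict Implicit.
Unset Printing Implicit Defensive.

Import Order.TTheory GRing.Theory Num.Theory.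
Import numFieldNormedType.Exports.

Local Open Scope classical_set_scope.
Local Open Scope ring_scope.

(** Everything rests on the increments $H(uv) - H(v)$, where $u$ is a single
    letter.  In a realization of $H$ with initial states
    $B_u = A_u x_0 + b_u - x_0$, the function $v \circ H_u$ is the image of
    $A_v B_u$ under the linear output map $x \mapsto (z \mapsto C A_z x)$
    ([hankel_generator]).  Hence a realization
    of dimension $n$ forces a Hankel rank of at most $n$
    ([realizes_finite_rank]).  Conversely the Hankel space itself, with the
    shifts as transition maps, carries a realization ([hankel_realization]), so
    a minimal realization has dimension at most the Hankel rank.

    When the dimension does not exceed the rank, a basis of the Hankel space
    lifts to a basis of the state space: the output map is injective and the
    vectors $A_v B_u$ span ([rank_dim_reach_obs]).  Since $A_w A_v B_u$ has the
    response $z \mapsto H(uvwz) - H(vwz)$, finite dimensionality gives one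
    constant $K$ such that a bound $d$ on the increments at words of length at
    least $t$ implies $\|A_w\|_2 \le K d$ whenever $|w| \ge t$
    ([transition_bound]).  If $H$ is UEF with rate $\beta$, taking
    $d = C_f \beta^t$ gives GUES with the same rate.  If $H$ is only UF, some
    $T$ makes all products of length at least $T$ have norm at most $1/2$, and
    submultiplicativity makes the decay exponential
    ([uniform_to_exponential]).

    In the other direction, a GUES realization has bounded states because its
    increments are dominated by a geometric series ([GUES_state_bound]); as
    $H(wv) - H(v) = C A_v (x_w - x_0)$, it is UEF with the same rate, hence
    UF. *)

(** * The Euclidean and spectral norms *)

Lemma norm2_ge0 (R : realType) (n : nat) (x : 'cV[R]_n) : 0 <= norm2 x.
Proof. exact: sqrtr_ge0. Qed.

Lemma sqr_norm2 (R : realType) (n : nat) (x : 'cV[R]_n) :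
  norm2 x ^+ 2 = \sum_(i < n) x i 0 ^+ 2.
Proof. by rewrite sqr_sqrtr // sumr_ge0 // => i _; rewrite sqr_ge0. Qed.

Lemma norm2_entry (R : realType) (n : nat) (x : 'cV[R]_n) (i : 'I_n) :
  `|x i 0| <= norm2 x.
Proof.
rewrite -sqrtr_sqr ler_sqrt; last by apply: sumr_ge0 => j _; rewrite sqr_ge0.
by rewrite (bigD1 i) //= lerDl sumr_ge0 // => j _; rewrite sqr_ge0.
Qed.

Lemma norm2_eq0 (R : realType) (n : nat) (x : 'cV[R]_n) : norm2 x = 0 -> x = 0.
Proof.
move=> x0; apply/matrixP => i j; rewrite (ord1 j) mxE.
by apply/eqP; rewrite -normr_le0 -x0 norm2_entry.
Qed.

Lemma norm2Z (R : realType) (n : nat) (a : R) (x : 'cV[R]_n) :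
  norm2 (a *: x) = `|a| * norm2 x.
Proof.
rewrite /norm2 -sqrtr_sqr -sqrtrM ?sqr_ge0// mulr_sumr; congr Num.sqrt.
by apply: eq_bigr => i _; rewrite mxE exprMn.
Qed.

Lemma norm2_0 (R : realType) (n : nat) : norm2 (0 : 'cV[R]_n) = 0.
Proof. by rewrite -(scale0r 0) norm2Z normr0 mul0r. Qed.

(** The convexity bound
    $(s + t)^2 \le (a + b) (s^2 / a + t^2 / b)$, with $a$ and $b$ the norms of
    the two vectors, gives the triangle inequality after summation over the
    coordinates. *)
Lemma norm2D (R : realType) (n : nat) (x y : 'cV[R]_n) :
  norm2 (x + y) <= norm2 x + norm2 y.
Proof.
have [/eqP/norm2_eq0 ->|x0] := boolP (norm2 x == 0).
  by rewrite add0r lerDr norm2_ge0.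
have [/eqP/norm2_eq0 ->|y0] := boolP (norm2 y == 0).
  by rewrite addr0 lerDl norm2_ge0.
have a0 : 0 < norm2 x by rewrite lt_def x0 norm2_ge0.
have b0 : 0 < norm2 y by rewrite lt_def y0 norm2_ge0.
have ab0 := ltW (addr_gt0 a0 b0).
rewrite -(ler_pXn2r (ltn0Sn 1)) ?nnegrE ?norm2_ge0// sqr_norm2.
set a := norm2 x; set b := norm2 y.
have -> : (a + b) ^+ 2 = \sum_(i < n)
    (a + b) * (x i 0 ^+ 2 / a + y i 0 ^+ 2 / b).
  rewrite -mulr_sumr big_split /= -!mulr_suml -!sqr_norm2 -/a -/b.
  by field; rewrite x0 y0.
apply: ler_sum => i _; rewrite mxE -subr_ge0.
suff -> : (a + b) * (x i 0 ^+ 2 / a + y i 0 ^+ 2 / b) - (x i 0 + y i 0) ^+ 2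
    = (b * x i 0 - a * y i 0) ^+ 2 / (a * b).
  by rewrite divr_ge0 ?sqr_ge0// mulr_ge0// ltW.
by field; rewrite x0 y0.
Qed.

Lemma norm2_sum (R : realType) (I : Type) (r : seq I) (n : nat)
    (F : I -> 'cV[R]_n) :
  norm2 (\sum_(i <- r) F i) <= \sum_(i <- r) norm2 (F i).
Proof.
elim/big_ind2 : _ => [|x a y b xa yb|//]; first by rewrite norm2_0.
exact: le_trans (norm2D _ _) (lerD _ _).
Qed.

Lemma mulmx_cols (R : realType) (m n : nat) (A : 'M[R]_(m, n)) (x : 'cV[R]_n) :
  A *m x = \sum_(j < n) x j 0 *: col j A.
Proof.
apply/matrixP => i j; rewrite (ord1 j) mxE summxE.
by apply: eq_bigr => k _; rewrite !mxE mulrC.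
Qed.

Lemma norm2_mulmx_cols (R : realType) (m n : nat) (A : 'M[R]_(m, n))
    (x : 'cV[R]_n) (d : R) :
  (forall j, `|x j 0| <= d) -> norm2 (A *m x) <= (\sum_j norm2 (col j A)) * d.
Proof.
move=> xd; rewrite mulmx_cols mulr_suml; apply: le_trans (norm2_sum _ _) _.
by apply: ler_sum => j _; rewrite norm2Z mulrC ler_wpM2l ?norm2_ge0.
Qed.

Lemma norm2_mulmx_bound (R : realType) (m n : nat) (A : 'M[R]_(m, n)) :
  exists2 K : R, 0 <= K & forall x, norm2 (A *m x) <= K * norm2 x.
Proof.
exists (\sum_j norm2 (col j A)).
  by apply: sumr_ge0 => j _; exact: norm2_ge0.
by move=> x; apply: norm2_mulmx_cols => j; exact: norm2_entry.
Qed.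

Lemma spectral_norm_le (R : realType) (m n : nat) (A : 'M[R]_(m, n)) (K : R) :
  0 <= K -> (forall x, norm2 (A *m x) <= K * norm2 x) -> spectral_norm A <= K.
Proof.
move=> K0 hA; apply: ge_sup.
  by exists (norm2 (A *m 0)); exists 0 => //=; rewrite norm2_0.
move=> _ [x /= x1 <-]; apply: le_trans (hA x) _.
by rewrite -[leRHS]mulr1 ler_wpM2l.
Qed.

Lemma norm2_mulmx (R : realType) (m n : nat) (A : 'M[R]_(m, n)) (x : 'cV[R]_n) :
  norm2 (A *m x) <= spectral_norm A * norm2 x.
Proof.
have [/eqP/norm2_eq0 ->|x0] := boolP (norm2 x == 0).
  by rewrite mulmx0 !norm2_0 mulr0.
have a0 : 0 < norm2 x by rewrite lt_def x0 norm2_ge0.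
rewrite -ler_pdivrMr//.
have -> : norm2 (A *m x) / norm2 x = norm2 (A *m ((norm2 x)^-1 *: x)).
  by rewrite -scalemxAr norm2Z ger0_norm ?invr_ge0 ?norm2_ge0// mulrC.
have [K K0 hK] := norm2_mulmx_bound A.
apply: ub_le_sup.
  exists K => _ [y /= y1 <-]; apply: le_trans (hK y) _.
  by rewrite -[leRHS]mulr1 ler_wpM2l.
exists ((norm2 x)^-1 *: x) => //=.
by rewrite norm2Z ger0_norm ?invr_ge0 ?norm2_ge0// mulVf.
Qed.

(** * Spans and independent families *)

Lemma lin_span_lin (R : realType) (V : lmodType R) (S : set V) (a : R)
    (x y : V) :
  lin_span S x -> lin_span S y -> lin_span S (a *: x + y).
Proof.
move=> [m1 [c1 [s1 [h1 ->]]]] [m2 [c2 [s2 [h2 ->]]]].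
exists (m1 + m2)%N.
exists (fun i : 'I_(m1 + m2) =>
  match fintype.split i with inl j => a * c1 j | inr j => c2 j end).
exists (fun i : 'I_(m1 + m2) =>
  match fintype.split i with inl j => s1 j | inr j => s2 j end).
split; first by move=> i; case: (fintype.split i).
rewrite big_split_ord /= scaler_sumr; congr (_ + _); apply: eq_bigr => i _.
  by rewrite -[lshift _ i]/(unsplit (inl i)) unsplitK scalerA.
by rewrite -[rshift _ i]/(unsplit (inr i)) unsplitK.
Qed.

Lemma lin_span_gen (R : realType) (V : lmodType R) (S : set V) :
  S `<=` lin_span S.
Proof.
move=> x Sx; exists 1%N, (fun=> 1), (fun=> x); split=> //.
by rewrite big_ord_recl big_ord0 scale1r addr0.
Qed.

Lemma lin_span0 (R : realType) (V : lmodType R) (S : set V) : lin_span S 0.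
Proof.
by exists 0%N, (fun=> 0), (fun=> 0); split; [case|rewrite big_ord0].
Qed.

Lemma lin_span_min (R : realType) (V : lmodType R) (S P : set V) :
  P 0 -> (forall a x y, P x -> P y -> P (a *: x + y)) -> S `<=` P ->
  lin_span S `<=` P.
Proof.
move=> P0 PD SP _ [m [c [s [h ->]]]].
elim/big_rec : _ => // i x _ Px; apply: PD => //; exact/SP/h.
Qed.

Lemma lin_span_sub (R : realType) (V : lmodType R) (S T : set V) :
  S `<=` lin_span T -> lin_span S `<=` lin_span T.
Proof.
apply: lin_span_min; first exact: lin_span0.
by move=> a x y; exact: lin_span_lin.
Qed.

Lemma lin_span_range (R : realType) (V : lmodType R) (n : nat)
    (e : 'I_n -> V) (v : V) :
  lin_span (range e) v -> exists c : 'I_n -> R, v = \sum_i c i *: e i.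
Proof.
move: v; apply: lin_span_min.
- by exists (fun=> 0); rewrite big1// => i _; rewrite scale0r.
- move=> a _ _ [c ->] [d ->]; exists (fun i => a * c i + d i).
  rewrite scaler_sumr -big_split; apply: eq_bigr => i _.
  by rewrite scalerDl scalerA.
- move=> _ [j _ <-]; exists (fun i => (i == j)%:R).
  rewrite (bigD1 j)//= eqxx scale1r big1 ?addr0// => i /negPf ->.
  by rewrite scale0r.
Qed.

Lemma lin_span_sum (R : realType) (V : lmodType R) (n : nat)
    (e : 'I_n -> V) (c : 'I_n -> R) :
  lin_span (range e) (\sum_i c i *: e i).
Proof. by exists n, c, e; split=> // i; exists i. Qed.

(** If the independent families inside $G$ have bounded size, one of maximal
    size spans: any generator outside its span could be added to it. *)
Lemma basis_from_generators (R : realType) (V : lmodType R) (G : set V)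
    (n : nat) :
  (forall k (e : 'I_k -> V), lin_indep e -> (forall i, G (e i)) ->
     (k <= n)%N) ->
  exists k (e : 'I_k -> V), [/\ forall i, G (e i), lin_indep e &
    lin_span (range e) = lin_span G].
Proof.
move=> bnd.
pose P k := `[< exists e : 'I_k -> V, lin_indep e /\ forall i, G (e i) >].
have P0 : exists k, P k.
  by exists 0%N; apply/asboolP; exists (fun=> 0); split; [move=> c _|]; case.
have Pn k : P k -> (k <= n)%N by move=> /asboolP[e [ei Ge]]; exact: bnd ei Ge.
case: (ex_maxnP P0 Pn) => k /asboolP[e [ei Ge]] kmax.
exists k, e; split=> //; rewrite eqEsubset; split.
  by apply: lin_span_sub => _ [i _ <-]; exact: lin_span_gen.
apply: lin_span_sub => g Gg; apply: contrapT => gN.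
suff : P k.+1 by move=> /kmax; rewrite ltnn.
apply/asboolP; exists (fun i => if unlift ord0 i is Some j then e j else g).
split; last by move=> i; case: (unlift ord0 i).
move=> c; rewrite big_ord_recl unlift_none.
under eq_bigr do rewrite liftK.
move=> c0.
have [c00|c00] := eqVneq (c ord0) 0.
  move: c0; rewrite c00 scale0r add0r => /ei ce i.
  by case: (unliftP ord0 i) => [j ->|->].
exfalso; apply: gN.
have -> : g = \sum_i (- (c ord0)^-1 * c (lift ord0 i)) *: e i.
  under eq_bigr do rewrite -scalerA.
  rewrite -scaler_sumr; move/eqP: c0; rewrite addr_eq0 => /eqP c0.
  by rewrite scaleNr -scalerN -c0 scalerA mulVf// scale1r.
exact: lin_span_sum.
Qed.

Definition rows_mx (R : realType) (k n : nat) (x : 'I_k -> 'cV[R]_n) :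
  'M[R]_(k, n) := \matrix_(i, j) x i j 0.

Lemma mul_rows_mx (R : realType) (k n : nat) (x : 'I_k -> 'cV[R]_n)
    (v : 'rV[R]_k) :
  (v *m rows_mx x)^T = \sum_i v 0 i *: x i.
Proof.
apply/matrixP => i j; rewrite (ord1 j) !mxE summxE.
by apply: eq_bigr => l _; rewrite !mxE.
Qed.

Lemma lin_indep_row_free (R : realType) (k n : nat) (x : 'I_k -> 'cV[R]_n) :
  lin_indep x -> row_free (rows_mx x).
Proof.
move=> xi; apply: inj_row_free => v /(congr1 trmx).
rewrite mul_rows_mx trmx0 => /(xi (v 0)) v0.
by apply/matrixP => i j; rewrite (ord1 i) v0 mxE.
Qed.

Lemma lin_indep_le (R : realType) (k n : nat) (x : 'I_k -> 'cV[R]_n) :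
  lin_indep x -> (k <= n)%N.
Proof. by move=> /lin_indep_row_free/eqP <-; exact: rank_leq_col. Qed.

Lemma lin_indep_spans (R : realType) (k n : nat) (x : 'I_k -> 'cV[R]_n)
    (y : 'cV[R]_n) :
  lin_indep x -> (n <= k)%N -> exists c : 'I_k -> R, y = \sum_i c i *: x i.
Proof.
move=> xi nk.
have kn : k = n by apply/eqP; rewrite eqn_leq nk (lin_indep_le xi).
have fx : row_full (rows_mx x).
  by rewrite /row_full -[X in _ == X]kn; exact: lin_indep_row_free.
exists ((y^T *m pinvmx (rows_mx x)) 0); rewrite -mul_rows_mx.
by rewrite -mulmxA mulVpmx// mulmx1 trmxK.
Qed.

(** * State-affine realizations and the Hankel space *)

Lemma foldl_word_mx (R : realType) (U : Type) (n : nat) (A : U -> 'M[R]_n)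
    (w : seq U) (M : 'M[R]_n) :
  foldl (fun M u => A u *m M) M w = word_mx A w *m M.
Proof.
rewrite /word_mx; elim: w M => [|u w IHw] M /=; first by rewrite mul1mx.
by rewrite IHw [in RHS]IHw mulmx1 mulmxA.
Qed.

Lemma word_mx_cat (R : realType) (U : Type) (n : nat) (A : U -> 'M[R]_n)
    (v w : seq U) :
  word_mx A (v ++ w) = word_mx A w *m word_mx A v.
Proof. by rewrite {1}/word_mx foldl_cat foldl_word_mx. Qed.

Lemma word_mx_cons (R : realType) (U : Type) (n : nat) (A : U -> 'M[R]_n)
    (u : U) (w : seq U) :
  word_mx A (u :: w) = word_mx A w *m A u.
Proof. by rewrite -cat1s word_mx_cat /word_mx /= mulmx1. Qed.

Lemma sas_state_catB (R : realType) (U : Type) (ny n : nat)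
    (S : sas R U ny n) (v w : seq U) :
  sas_state S (v ++ w) - sas_state S w =
  word_mx (sas_A S) w *m (sas_state S v - sas_x0 S).
Proof.
rewrite /sas_state foldl_cat; move: (foldl _ _ v) => x; move: (sas_x0 S) => y.
elim: w x y => [|u w IHw] x y /=; first by rewrite mul1mx.
rewrite IHw word_mx_cons -mulmxA; congr (_ *m _).
by rewrite mulmxBr opprD addrACA subrr addr0.
Qed.

Definition output_map (R : realType) (U : Type) (ny n : nat)
    (S : sas R U ny n) (x : 'cV[R]_n) : seq U -> 'cV[R]_ny :=
  fun z => sas_C S *m (word_mx (sas_A S) z *m x).

Definition reach_set (R : realType) (U : Type) (ny n : nat)
    (S : sas R U ny n) : set 'cV[R]_n :=
  [set x | exists (u : U) (v : seq U),
     x = word_mx (sas_A S) v *m sls_B (sas_sls S) u].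

Lemma output_map_sum (R : realType) (U : Type) (ny n k : nat)
    (S : sas R U ny n) (c : 'I_k -> R) (x : 'I_k -> 'cV[R]_n) :
  output_map S (\sum_i c i *: x i) = \sum_i c i *: output_map S (x i).
Proof.
apply/funext => z; rewrite fct_sumE /output_map !mulmx_sumr.
by apply: eq_bigr => i _; rewrite -!scalemxAr.
Qed.

Lemma output_map_word (R : realType) (U : Type) (ny n : nat)
    (S : sas R U ny n) (w z : seq U) (x : 'cV[R]_n) :
  output_map S (word_mx (sas_A S) w *m x) z = output_map S x (w ++ z).
Proof. by rewrite /output_map word_mx_cat -mulmxA. Qed.

Lemma lin_indep_output_map (R : realType) (U : Type) (ny n k : nat)
    (S : sas R U ny n) (x : 'I_k -> 'cV[R]_n) :
  lin_indep (fun i => output_map S (x i)) -> lin_indep x.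
Proof.
move=> yi c /(congr1 (output_map S)); rewrite output_map_sum => c0.
apply: yi; rewrite c0; apply/funext => z.
by rewrite /output_map !mulmx0.
Qed.

Lemma realizes_catB (R : realType) (U : Type) (ny n : nat)
    (H : seq U -> 'cV[R]_ny) (S : sas R U ny n) (v w : seq U) :
  sas_realizes S H ->
  H (v ++ w) - H w = output_map S (sas_state S v - sas_x0 S) w.
Proof.
move=> SH; rewrite !SH /output_map -sas_state_catB mulmxBr.
by rewrite opprD addrACA subrr addr0.
Qed.

Lemma realizes_consB (R : realType) (U : Type) (ny n : nat)
    (H : seq U -> 'cV[R]_ny) (S : sas R U ny n) (u : U) (w : seq U) :
  sas_realizes S H ->
  H (u :: w) - H w = output_map S (sls_B (sas_sls S) u) w.
Proof. exact: (@realizes_catB _ _ _ _ H S [:: u] w). Qed.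

(** The map from states to free output responses sends the vectors
    $A_v B_u$ to the generators of the Hankel space. *)
Lemma hankel_generator (R : realType) (U : Type) (ny n : nat)
    (H : seq U -> 'cV[R]_ny) (S : sas R U ny n) (u : U) (v : seq U) :
  sas_realizes S H ->
  word_shift v (assoc_family H u) =
  output_map S (word_mx (sas_A S) v *m sls_B (sas_sls S) u).
Proof.
move=> SH; apply/funext => z.
by rewrite output_map_word -(realizes_consB _ _ SH).
Qed.

Lemma realizes_finite_rank (R : realType) (U : Type) (ny n : nat)
    (H : seq U -> 'cV[R]_ny) (S : sas R U ny n) :
  sas_realizes S H -> finite_hankel_rank (assoc_family H).
Proof.
move=> SH.
have [k e ei Ge|k [e [_ ei espan]]] := @basis_from_generators _ _
    [set F | exists (j : U) (v : seq U), F = word_shift v (assoc_family H j)] n.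
  have /fin_all_exists[x ex] i : exists x : 'cV[R]_n, e i = output_map S x.
    have [u [v ->]] := Ge i.
    by exists (word_mx (sas_A S) v *m sls_B (sas_sls S) u);
      exact: hankel_generator.
  apply: (@lin_indep_le R k n x); apply: (@lin_indep_output_map _ _ _ _ _ S).
  by move: ei; congr lin_indep; apply/funext.
by exists k, e.
Qed.

Lemma hankel_basis_lift (R : realType) (U : Type) (ny n r : nat)
    (H : seq U -> 'cV[R]_ny) (S : sas R U ny n) :
  sas_realizes S H -> has_dim (hankel_space (assoc_family H)) r ->
  exists x : 'I_r -> 'cV[R]_n, (forall i, lin_span (reach_set S) (x i)) /\
    lin_indep (fun i => output_map S (x i)).
Proof.
move=> SH [e [ei espan]].
pose P := [set F | exists2 x, lin_span (reach_set S) x & F = output_map S x].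
have WP : hankel_space (assoc_family H) `<=` P.
  apply: lin_span_min.
  - exists 0; first exact: lin_span0.
    by apply/funext => z; rewrite /output_map !mulmx0.
  - move=> a _ _ [x xS ->] [y yS ->]; exists (a *: x + y).
      exact: lin_span_lin.
    by apply/funext => z; rewrite /output_map !mulmxDr -!scalemxAr.
  - move=> _ [u [v ->]].
    exists (word_mx (sas_A S) v *m sls_B (sas_sls S) u).
      by apply: lin_span_gen; exists u, v.
    exact: hankel_generator.
have /fin_all_exists2[x xS ex] i : P (e i).
  by apply: WP; rewrite -espan; apply: lin_span_gen; exists i.
exists x; split=> //.
by move: ei; congr lin_indep; apply/funext.
Qed.

Lemma hankel_space_shift (R : realType) (U : Type) (ny : nat)
    (H : seq U -> 'cV[R]_ny) (u : U) (F : seq U -> 'cV[R]_ny) :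
  hankel_space (assoc_family H) F ->
  hankel_space (assoc_family H) (word_shift [:: u] F).
Proof.
pose P F := hankel_space (assoc_family H) (word_shift [:: u] F).
move: F; apply: (@lin_span_min _ _ _ P).
- exact: lin_span0.
- by move=> a F G; exact: lin_span_lin.
- move=> _ [j [v ->]]; apply: lin_span_gen; exists j, (rcons v u).
  by apply/funext => z; rewrite /word_shift cat_rcons.
Qed.

(** The state reached by $w$ is the function $z \mapsto H(wz) - H(z)$, which
    lies in the Hankel space and starts at $0$.  Appending the letter $u$
    shifts it by $u$ and adds $H_u$, because
    $H(wuz) - H(z) = (H(wuz) - H(uz)) + (H(uz) - H(z))$; evaluation at the
    empty word is the output. *)
Lemma hankel_realization (R : realType) (U : Type) (ny r : nat)
    (H : seq U -> 'cV[R]_ny) :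
  has_dim (hankel_space (assoc_family H)) r ->
  exists S : sas R U ny r, sas_realizes S H.
Proof.
move=> [e [_ espan]].
have [co coE] : {co : (seq U -> 'cV[R]_ny) -> 'I_r -> R & forall F,
    hankel_space (assoc_family H) F -> F = \sum_i co F i *: e i}.
  apply: (@choice _ _ (fun F c => hankel_space (assoc_family H) F ->
    F = \sum_i c i *: e i)) => F.
  have [FW|nFW] := pselect (hankel_space (assoc_family H) F).
    by move: FW; rewrite -espan => /lin_span_range[c ->]; exists c.
  by exists (fun=> 0).
have eW j : hankel_space (assoc_family H) (e j).
  by rewrite -espan; apply: lin_span_gen; exists j.
pose A u := \matrix_(i, j) co (word_shift [:: u] (e j)) i : 'M[R]_r.
pose b u := \col_i co (assoc_family H u) i : 'cV[R]_r.
pose C := \matrix_(k, j) e j [::] k 0 : 'M[R]_(ny, r).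
pose S := SAS A b C (H [::]) 0.
pose fn (x : 'cV[R]_r) : seq U -> 'cV[R]_ny := \sum_i x i 0 *: e i.
have fnE x z : fn x z = \sum_i x i 0 *: e i z by rewrite /fn fct_sumE.
have fnA u x z : fn (A u *m x) z = fn x (u :: z).
  rewrite !fnE; under eq_bigr do rewrite mxE scaler_suml.
  rewrite exchange_big /=; apply: eq_bigr => j _.
  have -> : e j (u :: z) = word_shift [:: u] (e j) z by [].
  rewrite [in RHS](coE _ (hankel_space_shift u (eW j))) fct_sumE scaler_sumr.
  by apply: eq_bigr => i _; rewrite mxE scalerA mulrC.
have fnb u z : fn (b u) z = H (u :: z) - H z.
  have -> : H (u :: z) - H z = assoc_family H u z by [].
  rewrite [in RHS](coE (assoc_family H u)); last first.
    by apply: lin_span_gen; exists u, [::].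
  by rewrite fnE fct_sumE; apply: eq_bigr => i _; rewrite mxE.
have fnD x y z : fn (x + y) z = fn x z + fn y z.
  rewrite !fnE -big_split; apply: eq_bigr => i _.
  by rewrite mxE scalerDl.
have stE w z : fn (sas_state S w) z = H (w ++ z) - H z.
  elim/last_ind: w z => [|w u IHw] z.
    by rewrite subrr fnE big1// => i _; rewrite mxE scale0r.
  rewrite /sas_state foldl_rcons /= -/(sas_state S w) fnD fnA fnb IHw.
  by rewrite cat_rcons addrA subrK.
exists S => w /=.
have -> : C *m sas_state S w = fn (sas_state S w) [::].
  rewrite mulmx_cols fnE; apply: eq_bigr => j _; congr (_ *: _).
  by apply/matrixP => i l; rewrite (ord1 l) !mxE.
by rewrite stE cats0 subrK.
Qed.

(** * Estimates for realizations whose dimension is the Hankel rank *)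

(** Injectivity of the output map means that the rows of the matrices $C A_z$
    span the whole dual space; the state is then a fixed linear combination of
    finitely many output values. *)
Lemma observability_bound (R : realType) (U : Type) (ny n : nat)
    (S : sas R U ny n) :
  (forall x, (forall z, output_map S x z = 0) -> x = 0) ->
  exists2 K : R, 0 <= K & forall x d,
    (forall z, norm2 (output_map S x z) <= d) -> norm2 x <= K * d.
Proof.
move=> inj.
pose obs z i := (row i (sas_C S *m word_mx (sas_A S) z))^T.
have obsE z i x : (output_map S x z) i 0 = \sum_j obs z i j 0 * x j 0.
  rewrite /output_map mulmxA mxE; apply: eq_bigr => j _.
  by rewrite !mxE.
have [k e ei _|k [e [Ge ei espan]]] := @basis_from_generators _ _
    [set y | exists z i, y = obs z i] n; first exact: lin_indep_le ei.
have eE (x : 'cV[R]_n) i : (rows_mx e *m x) i 0 = \sum_j e i j 0 * x j 0.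
  by rewrite mxE; apply: eq_bigr => j _; rewrite mxE.
have e0 (x : 'cV[R]_n) : rows_mx e *m x = 0 -> x = 0.
  move=> ex0; apply: inj => z; apply/matrixP => i l.
  rewrite (ord1 l) obsE mxE.
  have /lin_span_range[c ->] : lin_span (range e) (obs z i).
    by rewrite espan; apply: lin_span_gen; exists z, i.
  under eq_bigr do rewrite summxE mulr_suml.
  rewrite exchange_big big1// => j _.
  under eq_bigr do rewrite mxE -mulrA.
  by rewrite -mulr_sumr -eE ex0 mxE mulr0.
have full : row_full (rows_mx e).
  rewrite /row_full -mxrank_tr; apply: inj_row_free => v ve0.
  apply: trmx_inj; rewrite trmx0; apply: e0.
  by apply: trmx_inj; rewrite trmx_mul trmxK trmx0.
exists (\sum_j norm2 (col j (pinvmx (rows_mx e)))).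
  by apply: sumr_ge0 => j _; exact: norm2_ge0.
move=> x d xd.
rewrite -[x in norm2 x]mul1mx -(mulVpmx full) -mulmxA.
apply: norm2_mulmx_cols => j; have [z [i eji]] := Ge j.
by rewrite eE eji -obsE; exact: le_trans (norm2_entry _ _) (xd z).
Qed.

Definition increments_le (R : realType) (U : Type) (ny : nat)
    (H : seq U -> 'cV[R]_ny) (t : nat) (d : R) : Prop :=
  forall u v, (t <= size v)%N -> norm2 (H (u :: v) - H v) <= d.

(** A basis of the Hankel space lifts to a basis of the state space made of
    combinations of the vectors $A_v B_u$; hence the output map is injective
    and every state is reachable up to linear combinations. *)
Lemma rank_dim_reach_obs (R : realType) (U : Type) (ny n r : nat)
    (H : seq U -> 'cV[R]_ny) (S : sas R U ny n) :
  sas_realizes S H -> has_dim (hankel_space (assoc_family H)) r ->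
  (n <= r)%N ->
  (forall x, lin_span (reach_set S) x) /\
  (forall x, (forall z, output_map S x z = 0) -> x = 0).
Proof.
move=> SH Wr nr; have [x [xS xi]] := hankel_basis_lift SH Wr.
have spanx y := lin_indep_spans y (lin_indep_output_map xi) nr.
split=> y; have [c ->] := spanx y.
  suff: lin_span (range x) `<=` lin_span (reach_set S).
    by apply; exact: lin_span_sum.
  by apply: lin_span_sub => _ [i _ <-].
move=> y0; rewrite big1// => i _; rewrite (xi c) ?scale0r//.
by rewrite -output_map_sum; apply/funext.
Qed.

(** For a vector $A_v B_u$ the response of $A_w A_v B_u$ at $z$ is
    $H(uvwz) - H(vwz)$, an increment of $H$ at a word at least as long as $w$;
    the observability bound turns this into a bound on the state, and finitely
    many combinations of such vectors give the canonical basis. *)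
Lemma transition_bound (R : realType) (U : Type) (hU : inhabited U)
    (ny n r : nat) (H : seq U -> 'cV[R]_ny) (S : sas R U ny n) :
  sas_realizes S H -> has_dim (hankel_space (assoc_family H)) r ->
  (n <= r)%N ->
  exists2 K : R, 0 <= K & forall t d, increments_le H t d ->
    forall w, (t <= size w)%N -> spectral_norm (word_mx (sas_A S) w) <= K * d.
Proof.
move=> SH Wr nr; have [reach obs] := rank_dim_reach_obs SH Wr nr.
have [K K0 hK] := observability_bound obs.
pose Q := [set y | exists2 Ky : R, 0 <= Ky & forall t d w,
  increments_le H t d -> (t <= size w)%N ->
  norm2 (word_mx (sas_A S) w *m y) <= Ky * d].
have Qall y : Q y.
  have := reach y; move: y; apply: lin_span_min.
  - by exists 0 => // *; rewrite mulmx0 norm2_0 mul0r.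
  - move=> a x y [Kx Kx0 hx] [Ky Ky0 hy]; exists (`|a| * Kx + Ky).
      by rewrite addr_ge0// mulr_ge0.
    move=> t d w Hd tw; rewrite mulmxDr; apply: le_trans (norm2D _ _) _.
    rewrite mulrDl lerD ?(hy t)// -scalemxAr norm2Z -mulrA.
    by rewrite ler_wpM2l// (hx t).
  - move=> _ [u [v ->]]; exists K => // t d w Hd tw; apply: hK => z.
    rewrite !output_map_word -(realizes_consB _ _ SH); apply: Hd.
    by rewrite !size_cat (leq_trans tw)// addnCA leq_addr.
have /fin_all_exists2[Kc Kc0 hKc] (j : 'I_n) : Q (delta_mx j 0) := Qall _.
exists (\sum_j Kc j); first exact: sumr_ge0.
move=> t d Hd w tw; have d0 : 0 <= d.
  by case: hU => u; exact: le_trans (norm2_ge0 _) (Hd u w tw).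
apply: spectral_norm_le => [|x]; first by rewrite mulr_ge0// sumr_ge0.
apply: le_trans (norm2_mulmx_cols _ (@norm2_entry _ _ x)) _.
rewrite ler_wpM2r ?norm2_ge0// mulr_suml.
by apply: ler_sum => j _; rewrite colE; exact: hKc Hd tw.
Qed.

Lemma initial_states_bound (R : realType) (U : Type) (ny n r : nat)
    (H : seq U -> 'cV[R]_ny) (S : sas R U ny n) (d : R) :
  sas_realizes S H -> has_dim (hankel_space (assoc_family H)) r ->
  (n <= r)%N -> increments_le H 0 d ->
  exists K : R, forall u, norm2 (sls_B (sas_sls S) u) <= K.
Proof.
move=> SH Wr nr Hd; have [_ obs] := rank_dim_reach_obs SH Wr nr.
have [K _ hK] := observability_bound obs.
exists (K * d) => u; apply: hK => z.
by rewrite -(realizes_consB _ _ SH); exact: Hd.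
Qed.

(** * Forgetting and stability *)

Lemma bernoulli_ge (R : realType) (x : R) (n : nat) :
  0 <= x <= 1 -> 1 - n%:R * x <= (1 - x) ^+ n.
Proof.
move=> /andP[x0 x1]; elim: n => [|n IHn]; first by rewrite mul0r subr0 expr0.
have n0 : 0 <= n%:R * x ^+ 2 :> R by rewrite mulr_ge0 ?sqr_ge0.
rewrite exprS -natr1; apply: le_trans (ler_wpM2l _ IHn); last by lra.
suff : (1 - x) * (1 - n%:R * x) - (1 - (n%:R + 1) * x) = n%:R * x ^+ 2 by lra.
by ring.
Qed.

(** The rate is $\beta = 1 - 1/(2T)$, for which $\beta^T \ge 1/2$ by
    Bernoulli's inequality.  Each block of $T$ letters split off a word
    contributes a factor at most $1/2 \le \beta^T$, and the remaining factor,
    shorter than $T$, is absorbed in the constant. *)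
Lemma uniform_to_exponential (R : realType) (U : Type) (n : nat)
    (A : U -> 'M[R]_n) (T : nat) (M : R) :
  (0 < T)%N ->
  (forall w, spectral_norm (word_mx A w) <= M) ->
  (forall w, (T <= size w)%N -> spectral_norm (word_mx A w) <= 2^-1) ->
  exists2 beta : R, 0 < beta < 1 & exists2 Cg : R, 1 <= Cg &
    forall w, spectral_norm (word_mx A w) <= Cg * beta ^+ size w.
Proof.
move=> T0 hM hT.
pose x : R := (2 * T%:R)^-1.
have Tr : 1 <= T%:R :> R by rewrite ler1n.
have xT : T%:R * x = 2^-1 by rewrite /x; field; apply/eqP => T00; lra.
have x0 : 0 < x by rewrite invr_gt0; lra.
have x1 : x <= 2^-1 by rewrite -xT ler_peMl// ltW.
pose beta := 1 - x.
have b0 : 0 < beta by rewrite /beta; lra.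
have b1 : beta < 1 by rewrite /beta; lra.
have bT : 2^-1 <= beta ^+ T.
  have x01 : 0 <= x <= 1 by lra.
  by have := bernoulli_ge T x01; rewrite xT -/beta; lra.
exists beta; first by rewrite b0.
have M0 : 0 <= Num.max 1 M by rewrite le_max ler01.
exists (2 * Num.max 1 M).
  have : 1 <= Num.max 1 M by rewrite le_max lexx.
  by lra.
move=> w; have [k] := ubnP (size w); elim: k w => // k IHk w wk.
have [wT|Tw] := ltnP (size w) T.
  have wb : 2^-1 <= beta ^+ size w.
    apply: le_trans bT _; apply: ler_wiXn2l;
      by rewrite ?(ltW b0) ?(ltW b1) ?(ltnW wT).
  apply: (@le_trans _ _ (Num.max 1 M)); first by rewrite le_max hM orbT.
  by rewrite mulrAC ler_peMl//; lra.
have -> : w = take T w ++ drop T w by rewrite cat_take_drop.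
have st : size (take T w) = T by rewrite size_takel.
have := IHk (drop T w); rewrite size_drop => /(_ _)/wrap[|hd].
  by rewrite ltn_subLR//; apply: leq_trans wk _; rewrite -addn1 addnC leq_add.
apply: spectral_norm_le => [|y].
  by rewrite !mulr_ge0 ?exprn_ge0 ?(ltW b0).
rewrite word_mx_cat -mulmxA; apply: le_trans (norm2_mulmx _ _) _.
apply: le_trans (ler_wpM2r (norm2_ge0 _) hd) _.
rewrite size_cat st size_drop -!mulrA.
rewrite exprD.
do 2 (rewrite ler_wpM2l//).
rewrite [beta ^+ T * _]mulrC -mulrA ler_wpM2l ?exprn_ge0 ?(ltW b0)//.
apply: le_trans (norm2_mulmx _ _) _; rewrite ler_wpM2r ?norm2_ge0//.
by apply: le_trans bT; apply: hT; rewrite st.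
Qed.

Lemma UEF_le (R : realType) (U : Type) (ny : nat)
    (H : seq U -> 'cV[R]_ny) (beta : R) :
  UEF H beta <-> 0 < beta < 1 /\ exists2 Cf : R, 0 < Cf & forall v w,
    norm2 (H (w ++ v) - H v) <= Cf * beta ^+ size v.
Proof.
split=> -[b01 [Cf Cf0 hC]]; split=> //; exists Cf => // v.
  move=> w; rewrite -lee_fin; apply: le_trans (hC v).
  by apply: ereal_sup_ubound; exists w.
by apply: ge_ereal_sup => _ [w ->]; rewrite lee_fin.
Qed.

Lemma UEF_increments (R : realType) (U : Type) (ny : nat)
    (H : seq U -> 'cV[R]_ny) (beta : R) :
  UEF H beta -> exists Cf : R, forall t, increments_le H t (Cf * beta ^+ t).
Proof.
move=> /UEF_le[/andP[b0 b1] [Cf Cf0 hC]]; exists Cf => t u v tv.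
apply: le_trans (hC v [:: u]) _; rewrite ler_wpM2l ?(ltW Cf0)//.
by apply: ler_wiXn2l; rewrite ?(ltW b0) ?(ltW b1).
Qed.

Lemma UF_increments (R : realType) (U : Type) (ny : nat)
    (H : seq U -> 'cV[R]_ny) :
  UF H -> (exists M : R, increments_le H 0 M) /\
    forall eps : R, 0 < eps -> exists T, increments_le H T eps.
Proof.
move=> [bnd lim0]; split.
  set s := ereal_sup _ in bnd.
  have sup u v : ((norm2 (H (u :: v) - H v))%:E <= s)%E.
    by apply: ereal_sup_ubound; exists v, u.
  case: s bnd sup => [M _ sup|//|_ sup].
    by exists M => u v _; rewrite -lee_fin.
  by exists 0 => u v _; have := sup u v.
move=> eps eps0.
have := lim0 _ (nbhs_open_ereal_lt (f := fun=> eps) eps0).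
move=> [T _ hT]; exists T.+1 => u v Tv.
rewrite -lee_fin; apply: ltW; apply: le_lt_trans (hT (size v) _); last first.
  exact: ltnW.
apply: ereal_sup_ubound; exists v, [:: u]; split=> //.
exact: leq_trans Tv.
Qed.

Lemma UEF_UF (R : realType) (U : Type) (hU : inhabited U) (ny : nat)
    (H : seq U -> 'cV[R]_ny) (beta : R) :
  UEF H beta -> UF H.
Proof.
move=> HE; have [Cf0 hCf0] := UEF_increments HE.
have [/andP[b0 b1] [Cf Cf_gt0 hC]] := (UEF_le H beta).1 HE.
split.
  apply: (@le_lt_trans _ _ (Cf0 * beta ^+ 0)%:E); last exact: ltry.
  by apply: ge_ereal_sup => _ [v [u ->]]; rewrite lee_fin; exact: hCf0.
have lim0 : (fun t : nat => (Cf * beta ^+ t)%:E) @ \oo --> 0%E.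
  apply: cvg_EFin; first by near=> t.
  rewrite -[X in _ --> X](mulr0 Cf); apply: cvgM; first exact: cvg_cst.
  by apply: cvg_expr; rewrite ger0_norm ?ltW.
apply: (squeeze_cvge _ (cvg_cst 0%E) lim0).
near=> t.
have t0 : (0 < t)%N by near: t; exact: nbhs_infty_gt.
apply/andP; split.
  case: hU => u; apply: (@le_trans _ _ (norm2 (H ([::] ++ nseq t u) -
    H (nseq t u)))%:E); first by rewrite lee_fin norm2_ge0.
  apply: ereal_sup_ubound; exists (nseq t u), [::].
  by rewrite size_nseq.
by apply: ge_ereal_sup => _ [v [w [_ vt ->]]]; rewrite lee_fin -vt.
Unshelve. all: by end_near.
Qed.

(** The increment $x_{uv} - x_v = A_v B_u$ is at most $C_g K \beta^{|v|}$;
    summed over the suffixes of a word these bounds form a geometric series. *)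
Lemma GUES_state_bound (R : realType) (U : Type) (ny n : nat)
    (S : sas R U ny n) (beta : R) :
  sas_GUES_rate S beta ->
  exists2 D : R, 0 <= D & forall v, norm2 (sas_state S v - sas_x0 S) <= D.
Proof.
move=> [/andP[b0 b1] [K hK] [Cg Cg1 hCg]].
have Cg0 : 0 <= Cg by lra.
have K'0 : 0 <= `|K| by [].
pose D := Cg * `|K| / (1 - beta).
have D0 : 0 <= D by rewrite divr_ge0 ?mulr_ge0// subr_ge0 ltW.
exists D => // v.
apply: (@le_trans _ _ (D * (1 - beta ^+ size v))); last first.
  by rewrite -[leRHS]mulr1 ler_wpM2l// gerBl exprn_ge0// ltW.
elim: v => [|u v IHv] /=.
  by rewrite /sas_state /= subrr norm2_0 expr0 subrr mulr0.
rewrite -(subrK (sas_state S v) (sas_state S (u :: v))) -addrA.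
apply: le_trans (norm2D _ _) _.
have step : norm2 (sas_state S (u :: v) - sas_state S v) <=
    Cg * `|K| * beta ^+ size v.
  rewrite (sas_state_catB S [:: u] v); apply: le_trans (norm2_mulmx _ _) _.
  apply: (@le_trans _ _ (Cg * beta ^+ size v * `|K|)); last by rewrite mulrAC.
  apply: le_trans (ler_wpM2r (norm2_ge0 _) (hCg v)) _.
  rewrite ler_wpM2l ?mulr_ge0 ?exprn_ge0 ?(ltW b0)//.
  exact: le_trans (hK u) (ler_norm _).
apply: le_trans (lerD step IHv) _.
rewrite le_eqVlt; apply/orP; left; apply/eqP.
rewrite /D exprS; field.
by rewrite subr_eq0 gt_eqF.
Qed.

Lemma GUES_UEF (R : realType) (U : Type) (ny n : nat)
    (H : seq U -> 'cV[R]_ny) (S : sas R U ny n) (beta : R) :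
  sas_realizes S H -> sas_GUES_rate S beta -> UEF H beta.
Proof.
move=> SH SG; have [D D0 hD] := GUES_state_bound SG.
have [/andP[b0 b1] _ [Cg Cg1 hCg]] := SG.
have [K K0 hK] := norm2_mulmx_bound (sas_C S).
have KCD0 : 0 <= K * Cg * D by rewrite !mulr_ge0//; lra.
apply/UEF_le; split; first by rewrite b0.
(* Adding one keeps the constant positive when D or K is zero. *)
exists (K * Cg * D + 1) => [|v w]; first by lra.
rewrite (realizes_catB _ _ SH); apply: le_trans (hK _) _.
apply: (@le_trans _ _ (K * (Cg * beta ^+ size v * D))).
  rewrite ler_wpM2l//; apply: le_trans (norm2_mulmx _ _) _.
  apply: le_trans (ler_wpM2r (norm2_ge0 _) (hCg v)) _.
  rewrite ler_wpM2l// mulr_ge0 ?exprn_ge0 ?(ltW b0)//; lra.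
have : 0 <= beta ^+ size v by rewrite exprn_ge0 ?ltW.
by move: (beta ^+ _) => p p0; rewrite mulrDl; lra.
Qed.

Lemma UF_GUES (R : realType) (U : Type) (hU : inhabited U) (ny n r : nat)
    (H : seq U -> 'cV[R]_ny) (S : sas R U ny n) :
  sas_realizes S H -> has_dim (hankel_space (assoc_family H)) r ->
  (n <= r)%N -> UF H -> sas_GUES S.
Proof.
move=> SH Wr nr /UF_increments[[M HM] Heps].
have [K K0 hK] := transition_bound hU SH Wr nr.
have K1 : 0 < K + 1 by lra.
have eps0 : 0 < (2 * (K + 1))^-1 by rewrite invr_gt0; lra.
have [T HT] := Heps _ eps0.
have half : K * (2 * (K + 1))^-1 <= 2^-1.
  by rewrite invfM mulrCA ler_piMr// ler_pdivrMr//; lra.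
have [|w|w Tw|beta b01 [Cg Cg1 hCg]] := @uniform_to_exponential _ _ _
    (sas_A S) T.+1 (K * M).
- by [].
- exact: (hK _ _ HM w).
- by apply: le_trans half; apply: (hK _ _ HT w); exact: ltnW.
exists beta; split=> //; last by exists Cg.
exact: initial_states_bound SH Wr nr HM.
Qed.

Lemma UEF_GUES_rate (R : realType) (U : Type) (hU : inhabited U)
    (ny n r : nat) (H : seq U -> 'cV[R]_ny) (S : sas R U ny n) (beta : R) :
  sas_realizes S H -> has_dim (hankel_space (assoc_family H)) r ->
  (n <= r)%N -> UEF H beta -> sas_GUES_rate S beta.
Proof.
move=> SH Wr nr HE; have [Cf hCf] := UEF_increments HE.
have [b01 _] := HE; have /andP[b0 _] := b01.
have [K K0 hK] := transition_bound hU SH Wr nr.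
split=> //.
  exact: initial_states_bound SH Wr nr (hCf 0%N).
exists (Num.max 1 (K * Cf)) => [|w]; first by rewrite le_max lexx.
apply: le_trans (hK _ _ (hCf (size w)) w (leqnn _)) _.
by rewrite mulrA ler_wpM2r ?exprn_ge0 ?(ltW b0)// le_max lexx orbT.
Qed.

Theorem mainTheorem2 (R : realType) (U : Type) (hU : inhabited U) (ny : nat)
    (H : seq U -> 'cV[R]_ny) :
  ((exists (n : nat) (S : sas R U ny n), sas_realizes S H /\ sas_GUES S) <->
     (UF H /\ finite_hankel_rank (assoc_family H))) /\
  (finite_hankel_rank (assoc_family H) ->
     (UF H <-> exists beta : R, UEF H beta)) /\
  (forall beta : R, UEF H beta ->
     forall (n : nat) (S : sas R U ny n),
       sas_minimal S H -> sas_GUES_rate S beta).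
Proof.
have UF_realization : UF H -> finite_hankel_rank (assoc_family H) ->
    exists (n : nat) (S : sas R U ny n), sas_realizes S H /\ sas_GUES S.
  move=> HUF [r Wr]; have [S SH] := hankel_realization Wr.
  by exists r, S; split=> //; exact: UF_GUES SH Wr (leqnn r) HUF.
split; [split|split].
- move=> [n [S [SH [beta SG]]]]; split; last exact: realizes_finite_rank SH.
  exact (UEF_UF hU (GUES_UEF SH SG)).
- by move=> [HUF Hfin]; exact: UF_realization.
- move=> Hfin; split=> [HUF|[beta]]; last exact: (UEF_UF hU).
  have [n [S [SH [beta SG]]]] := UF_realization HUF Hfin.
  by exists beta; exact: GUES_UEF SH SG.
- move=> beta HE n S [SH Smin]; have [r Wr] := realizes_finite_rank SH.
  have [S' S'H] := hankel_realization Wr.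
  exact: UEF_GUES_rate SH Wr (Smin _ _ S'H) HE.
Qed.
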